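(* Let $\mathbb{F}_q$ be a finite field, let $x=\frac{s\log q}{\log(1+1/r)}$ with integers $s,r\ge1$, let $a_k=a_k(x)=\left\lfloor \frac{1}{q^{k/x}-1}\right\rfloor$ and $\hat{h}(x)=\prod_{k\ge1}\prod_{p\in\mathcal{I}_k}p^{a_k}$. Let $h$ be an $x$-semi-superior highly composite polynomial of degree $\deg\hat{h}(x)-vs$ with $0\le v<\pi(s)$. Let $N=\deg h-u$ with $0\le u\le s-1$, and let $T(N)=\max\{\tau(f): f\in\mathcal{M}_N\}$. Then $\log T(N)=\log\tau(h)$ if $u=0$, and if $1\le u\le s-1$ then $\log T(N)=\log\tau(h)-\epsilon(N)$ where $$\frac{u}{s}\log\left(1+\frac1r\right)\le \epsilon(N)\le \log\left(1+\frac{1}{a_u}\right).$$ Moreover, the length of this range for $\epsilon(N)$ is at most $\log\left(1+\frac{1}{a_u(a_u+2)}\right)\le \log\frac43$.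
   Context: $\mathcal{M}$ is the set of monic polynomials in $\mathbb{F}_q[t]$, $\mathcal{M}_N$ those of degree $N$, $\mathcal{I}_k$ the set of monic irreducible polynomials of degree $k$, and $\pi(k)=|\mathcal{I}_k|$. For $f\in\mathcal{M}$, $\tau(f)$ is the number of monic divisors of $f$. For $x>0$, $h\in\mathcal{M}$ is $x$-semi-superior highly composite if $\tau(h)/q^{\deg h/x}\ge \tau(f)/q^{\deg f/x}$ for all $f\in\mathcal{M}$. *)

(* Defs.v *)
From mathcomp Require Import all_boot all_order all_algebra.
From mathcomp Require Import finmap.
From mathcomp Require Import all_classical all_reals all_analysis.

Set Implicit Arguments.
Unset Strict Implicit.
Unset Printing Implicit Defensive.
Import Order.TTheory GRing.Theory Num.Theory.
Local Open Scope classical_set_scope.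
Local Open Scope ring_scope.

Section Polynomials.
Variable F : finFieldType.
Implicit Types f p d : {poly F}.

(* Only used for nonzero polynomials. *)
Definition deg f : nat := (size f).-1.

Definition monics (N : nat) : set {poly F} :=
  [set f | f \is monic /\ deg f = N].

Definition irreds (k : nat) : set {poly F} :=
  [set p | [/\ p \is monic, irreducible_poly p & deg p = k]].

Definition monic_divisors f : set {poly F} :=
  [set d | d \is monic /\ d %| f].

(* [fset_set A] is junk when [A] is infinite; the sets it is applied to below
   are finite by [finite_monics], [finite_irreds] and
   [finite_monic_divisors]. *)
Lemma finite_size_le (n : nat) : finite_set [set f : {poly F} | (size f <= n)%N].
Proof.
apply: (@sub_finite_set _ _ (range (@rVpoly F n))); last first.
  exact/finite_image/finite_finset.
by move=> f /= fn; exists (poly_rV f) => //; rewrite poly_rV_K.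
Qed.

Lemma finite_monics (N : nat) : finite_set (monics N).
Proof.
apply: sub_finite_set (finite_size_le N.+1) => f [_ <-] /=.
by rewrite /deg; case: (size f).
Qed.

Lemma finite_irreds (k : nat) : finite_set (irreds k).
Proof. by apply: sub_finite_set (finite_monics k) => p [pm _ pk]. Qed.

Lemma finite_monic_divisors f : f != 0 -> finite_set (monic_divisors f).
Proof.
move=> f0; apply: sub_finite_set (finite_size_le (size f)) => d [_ df] /=.
exact: dvdp_leq.
Qed.

Definition num_irreds (k : nat) : nat := #|` fset_set (irreds k)|.

Definition tau f : nat := #|` fset_set (monic_divisors f)|.

Definition maxtau (N : nat) : nat := (\max_(f <- fset_set (monics N)) tau f)%N.

End Polynomials.

Arguments monics : clear implicits.
Arguments irreds : clear implicits.

Section SemiSuperior.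
Variables (R : realType) (F : finFieldType).
Implicit Types (x : R) (h f : {poly F}).

Definition semi_superior x h : Prop :=
  h \is monic /\
  forall f, f \is monic ->
    (tau f)%:R / #|F|%:R `^ ((deg f)%:R / x) <=
    (tau h)%:R / #|F|%:R `^ ((deg h)%:R / x).

(* For x > 0 and k >= 1 the argument of [Num.truncn] is positive, so that
   [Num.truncn] is the floor function. *)
Definition expo x (k : nat) : nat :=
  Num.truncn ((#|F|%:R `^ (k%:R / x) - 1)^-1 : R).

(* The outer product is an infinite product with finitely many factors
   different from 1, by [hhat_finite_support]. *)
Definition hhat x : {poly F} :=
  \big[*%R/1]_(k \in [set k | (1 <= k)%N])
    \prod_(p <- fset_set (irreds F k)) p ^+ expo x k.

Lemma expo_eq0 x (k : nat) : 0 < x -> x < k%:R -> expo x k = 0%N.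
Proof.
move=> x0 xk; apply/eqP; rewrite /expo -leqn0 truncn_le_nat.
have q2 : 2 <= #|F|%:R :> R
  by rewrite ler_nat; apply/card_gt1P; exists 0, 1; rewrite // eq_sym oner_neq0.
have k1 : 1 < k%:R / x by rewrite ltr_pdivlMr// mul1r.
have : (2 : R) < #|F|%:R `^ (k%:R / x).
  apply: (le_lt_trans q2); rewrite -[ltLHS]powRr1// /powR.
  have q0 : #|F|%:R != 0 :> R by rewrite gt_eqF// (lt_le_trans _ q2).
  rewrite (negbTE q0) ltr_expR ltr_pM2r// ln_gt0//.
  by rewrite (lt_le_trans _ q2)// ltr1n.
rewrite -(ltrBrDr 1) => H; rewrite invf_lt1//; last by rewrite (lt_trans _ H).
Qed.

Lemma hhat_finite_support x : 0 < x ->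
  finite_set ([set k | (1 <= k)%N] `&`
    (fun k => \prod_(p <- fset_set (irreds F k)) p ^+ expo x k)
      @^-1` [set~ 1]).
Proof.
move=> x0; apply: sub_finite_set (finite_II (Num.truncn x).+2).
move=> k [_ /= pk]; rewrite ltnNge; apply/negP => kx; apply: pk.
apply: big1 => p _; rewrite expo_eq0 ?expr0//.
by apply: (lt_le_trans (truncnS_gt x)); rewrite ler_nat ltnW.
Qed.

End SemiSuperior.

Arguments expo {R} F x k.
Arguments hhat {R} F x.

(* Main.v *)
Require Import Defs.
From mathcomp Require Import all_boot all_order all_algebra all_field.
From mathcomp Require Import finmap ring lra zify.
From mathcomp Require Import all_classical all_reals all_analysis.
Set Implicit Arguments.
Unset Strict Implicit.
Unset Printing Implicit Defensive.
Import Order.TTheory GRing.Theory Num.Theory.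
Local Open Scope ring_scope.

(* Put Q = q ^ (u / x) = (1 + 1 / r) ^ (u / s). Comparing the value of
   tau f / q ^ (deg f / x) at h with its value at the polynomials of degree N
   gives T(N) <= tau h / Q, which is the lower bound for epsilon. For the upper
   bound, let p be irreducible of degree u and e its exponent in h. Comparing h
   with p h and h / p gives e <= 1 / (Q - 1) <= e + 1, and the right inequality
   is strict: Q = 1 + 1 / m with u < s would give m ^ s = r ^ u by coprimality,
   hence m <= r and Q >= 1 + 1 / r, a contradiction. So e = a_u, and h / p, of
   degree N, has tau (h / p) = tau h / (1 + 1 / a_u). *)

(** * Irreducible polynomials of every positive degree over a finite field *)

(** The derivative is [-1], because the characteristic divides [#|F| ^ n]. *)
Lemma separable_Xcard_subX (F : finFieldType) (L : fieldExtType F) (n : nat) :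
  (0 < n)%N -> separable_poly ('X^(#|F| ^ n) - 'X : {poly L}).
Proof.
move=> n0; have [p _ pF] := finPcharP F.
have p_dvd : (p %| #|F|)%N.
  have := finNzRing_gt1 F; have : #|F| = _ := card_pprimeChar pF.
  by case: logn => [-> //|k ->] _; rewrite dvdn_exp.
have pL : p \in [pchar L] by rewrite pchar_lalg.
have m0 : (#|F| ^ n)%:R == 0 :> L by rewrite -(dvdn_pcharf pL) dvdn_exp.
rewrite separable_poly.unlock derivB derivXn derivX -scaler_nat (eqP m0).
rewrite scale0r sub0r -[-1]scaleN1r coprimepZr ?coprimep1 //.
by rewrite oppr_eq0 oner_eq0.
Qed.

(** With q = [#|F|], the roots of X^(q^n) - X in a splitting field are the fixed points of the
    [n]-th power of Frobenius, so they form a subfield; separability makes them q^n in number. *)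
Lemma exists_subfield_dim (F : finFieldType) (n : nat) : (0 < n)%N ->
  exists (L : splittingFieldType F) (E : {subfield L}), \dim E = n.
Proof.
move=> n0; set m := (#|F| ^ n)%N.
have q1 : (1 < #|F|)%N := finNzRing_gt1 F.
have m1 : (1 < m)%N by rewrite -(expn0 #|F|) ltn_exp2l.
have szq (A : nzRingType) : size ('X^m - 'X : {poly A}) = m.+1.
  by rewrite size_polyDl size_polyXn // size_polyN size_polyX.
have /FinSplittingFieldFor[L [zs Dq _]] : ('X^m - 'X : {poly F}) != 0.
  by rewrite -size_poly_gt0 szq.
rewrite [map_poly _ _]rmorphB /= map_polyXn map_polyX in Dq.
have Uzs : uniq zs.
  by rewrite -separable_prod_XsubC -(eqp_separable Dq) separable_Xcard_subX.
(* By [Da], the generator [a] is the Frobenius map z -> z^q. *)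
have [/= a _ Da] := finField_galois_generator (sub1v {:L}).
rewrite dimv1 expn1 in Da.
pose E := [aspace of fixedSpace (a ^+ n)%g].
have in_zs : zs =i E.
  move=> z; rewrite -root_prod_XsubC -(eqp_root Dq) (sameP fixedSpaceP eqP).
  have -> k : (a ^+ k)%g z = z ^+ (#|F| ^ k).
    elim: k => [|k IH]; first by rewrite gal_id.
    by rewrite expgSr galM ?memvf // Da ?memvf // IH -exprM expnSr.
  by rewrite /root !hornerE subr_eq0.
exists L, E; apply/eqP; rewrite -(eqn_exp2l _ _ q1).
have szE : #|(E : {vspace finvect_type L})| = size zs.
  have /card_uniqP <- : uniq (zs : seq (finvect_type L)) := Uzs.
  by apply: eq_card => z; rewrite -in_zs.
rewrite -(card_vspace (E : {vspace finvect_type L})) szE.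
by rewrite -eqSS -(size_prod_XsubC _ id) -(eqp_size Dq) szq.
Qed.

(** The minimal polynomial over [F] of a primitive element of a field of dimension [n] has these
    properties. *)
Lemma exists_irreducible_poly (F : finFieldType) (n : nat) : (0 < n)%N ->
  exists p : {poly F}, [/\ p \is monic, irreducible_poly p & size p = n.+1].
Proof.
move=> n0; have [L [E dimE]] := exists_subfield_dim F n0.
have /and3P[_ sepE _] := finField_galois (sub1v E).
pose z := separable_generator 1 E.
have defE : <<1; z>>%VS = E by rewrite -eq_adjoin_separable_generator ?sub1v.
have /polyOver1P[p Dp] := minPolyOver 1 z.
have szp : size p = n.+1.
  rewrite -(size_map_poly (in_alg L)) -Dp size_minPoly adjoin_degreeE.
  by rewrite defE dimE dimv1 divn1.
exists p; split => //.
  by rewrite -(map_monic (in_alg L)) -Dp monic_minPoly.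
split=> [|d d1 dp]; first by rewrite szp.
have : map_poly (in_alg L) d %| minPoly 1 z by rewrite Dp dvdp_map.
move=> /minPoly_irr; rewrite Dp -(rmorph1 (map_poly (in_alg L))) !eqp_map.
case/(_ _)/orP => //; first by apply/polyOver1P; exists d.
by rewrite -size_poly_eq1 (negbTE d1).
Qed.

(** * Divisor counts and powers of an irreducible factor *)

Section Tau.
Variables (F : finFieldType) (p : {poly F}).
Hypotheses (p_monic : p \is monic) (p_irr : irreducible_poly p).
Implicit Types g h : {poly F}.

(** A divisor not divisible by [p] is coprime to [p ^+ e.+1], hence divides [g]; from any other one
    a factor [p] can be cancelled. *)
Lemma monic_divisors_expSM (e : nat) g : ~~ (p %| g) ->
  (monic_divisors (p ^+ e.+1 * g) =
   monic_divisors g `|` [set p * d | d in monic_divisors (p ^+ e * g)])%classic.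
Proof.
move=> pg; apply/seteqP; split => d /=.
  case=> + +; have [/dvdpP[d' ->]|pd] := boolP (p %| d).
    rewrite monicMr // => d'_monic.
    rewrite exprS -mulrA mulrC dvdp_mul2l ?monic_neq0 // => d'g.
    right; exists d'; rewrite // mulrC.
  move=> d_monic; rewrite Gauss_dvdpr; first by left.
  by rewrite coprimep_expr // coprimep_sym irreducible_poly_coprime.
case=> [[d_monic dg]|[d' [d'_monic d'g] <-]]; split => //.
- by rewrite dvdp_mull.
- by rewrite monicMl.
- by rewrite exprS -mulrA dvdp_mul2l ?monic_neq0.
Qed.

Lemma tau_expM (e : nat) g : g != 0 -> ~~ (p %| g) ->
  tau (p ^+ e * g) = (e.+1 * tau g)%N.
Proof.
move=> g0 pg; elim: e => [|e IH]; first by rewrite expr0 !mul1r mul1n.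
have p0 := monic_neq0 p_monic.
have fin1 := finite_monic_divisors g0.
have fin2 : finite_set (monic_divisors (p ^+ e * g)).
  by apply: finite_monic_divisors; rewrite mulf_neq0 ?expf_neq0.
rewrite mulSn -IH /tau monic_divisors_expSM // fset_setU //; last first.
  exact: finite_image.
rewrite cardfsU -fset_setI //; last exact: finite_image.
(* The union is disjoint: a common element would make [p] divide [g]. *)
rewrite (_ : (_ `&` _)%classic = set0); last first.
  rewrite -subset0 => d' [[_ d'g] [d _ dE]]; case/negP: pg.
  by apply: dvdp_trans d'g; rewrite -dE dvdp_mulr.
rewrite fset_set0 cardfs0 subn0 fset_set_image // card_imfset //.
exact: mulfI.
Qed.

Lemma monic_factor_out h : h \is monic ->
  exists e g, [/\ h = p ^+ e * g, g \is monic & ~~ (p %| g)].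
Proof.
have [n] := ubnP (size h); elim: n h => // n IH h szh h_monic.
have [/dvdpP[h' hE]|ph] := boolP (p %| h); last first.
  by exists 0%N, h; rewrite expr0 mul1r.
have h'_monic : h' \is monic by move: h_monic; rewrite hE monicMr.
have [|e [g [h'E g_monic pg]]] := IH h' _ h'_monic.
  move: szh; rewrite hE size_Mmonic ?monic_neq0 //.
  by have p1 : (1 < size p)%N := p_irr.1; lia.
by exists e.+1, g; rewrite hE h'E exprS; split => //; ring.
Qed.

End Tau.

Lemma degM (F : finFieldType) (f g : {poly F}) : f != 0 -> g != 0 ->
  deg (f * g) = (deg f + deg g)%N.
Proof.
move=> f0 g0; have : size (f * g) = (size f + size g).-1 by apply: size_mul.
have : (0 < size f)%N by rewrite size_poly_gt0.
have : (0 < size g)%N by rewrite size_poly_gt0.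
by rewrite /deg; lia.
Qed.

Lemma tau_gt0 (F : finFieldType) (f : {poly F}) : f != 0 -> (0 < tau f)%N.
Proof.
move=> f0; rewrite /tau cardfs_gt0; apply/fset0Pn; exists 1.
rewrite in_fset_set; last exact: finite_monic_divisors.
by apply/mem_set; split; rewrite ?monic1 ?dvd1p.
Qed.

(* The fractions [((m + 1) / m) ^ s] and [((r + 1) / r) ^ u] are in lowest
   terms, so their denominators agree. *)
Lemma succ_ratio_exp_inj (m r s u : nat) :
  (m.+1 ^ s * r ^ u = m ^ s * r.+1 ^ u)%N -> (m ^ s = r ^ u)%N.
Proof.
move=> E; apply/eqP; rewrite eqn_dvd.
have cop k i j : coprime (k ^ i) (k.+1 ^ j).
  by rewrite coprimeXl // coprimeXr // coprimenS.
apply/andP; split.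
  by rewrite -(Gauss_dvdr _ (cop m s s)) E dvdn_mulr.
by rewrite -(Gauss_dvdl _ (cop r u u)) -E dvdn_mull.
Qed.

(** * Exponents of irreducible factors in a semi-superior polynomial *)

Section Exponents.
Variables (R : realType) (F : finFieldType) (x : R).
Hypothesis x_gt0 : 0 < x.

Let q_gt1 : 1 < #|F|%:R :> R.
Proof. by rewrite ltr1n finNzRing_gt1. Qed.

Let q_gt0 : 0 < #|F|%:R :> R.
Proof. exact: lt_trans q_gt1. Qed.

Lemma powR_card_gt1 (k : nat) : (0 < k)%N -> 1 < #|F|%:R `^ (k%:R / x).
Proof.
move=> k0; rewrite /powR gt_eqF // expR_gt1 mulr_gt0 ?ln_gt0 //.
by rewrite divr_gt0 // ltr0n.
Qed.

Lemma semi_superior_tau_le (h f : {poly F}) (k : nat) :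
  semi_superior x h -> f \is monic -> (deg f + k = deg h)%N ->
  (tau f)%:R * #|F|%:R `^ (k%:R / x) <= (tau h)%:R.
Proof.
move=> [_ /(_ f) hmax] f_monic degh; move: (hmax f_monic).
rewrite -degh natrD mulrDl powRD; last by apply/implyP => _; rewrite gt_eqF.
rewrite invfM mulrA [leRHS]mulrAC ler_pM2r ?invr_gt0 ?powR_gt0 //.
by rewrite ler_pdivlMr ?powR_gt0.
Qed.

Lemma semi_superior_tau_ge (h f : {poly F}) (k : nat) :
  semi_superior x h -> f \is monic -> (deg h + k = deg f)%N ->
  (tau f)%:R <= (tau h)%:R * #|F|%:R `^ (k%:R / x).
Proof.
move=> [_ /(_ f) hmax] f_monic degf; move: (hmax f_monic).
rewrite -degf natrD mulrDl powRD; last by apply/implyP => _; rewrite gt_eqF.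
rewrite invfM mulrA [leLHS]mulrAC ler_pM2r ?invr_gt0 ?powR_gt0 //.
by rewrite ler_pdivrMr ?powR_gt0.
Qed.

Lemma semi_superior_exponent (p g : {poly F}) (e : nat) :
  p \is monic -> irreducible_poly p -> g \is monic -> ~~ (p %| g) ->
  semi_superior x (p ^+ e * g) ->
  e%:R <= (#|F|%:R `^ ((deg p)%:R / x) - 1)^-1 <= e.+1%:R.
Proof.
move=> p_monic p_irr g_monic pg hsup.
have g0 := monic_neq0 g_monic; have p0 := monic_neq0 p_monic.
have monic_i i : p ^+ i * g \is monic by rewrite rpredM ?rpredX.
have degS i : deg (p ^+ i.+1 * g) = (deg (p ^+ i * g) + deg p)%N.
  by rewrite exprS -mulrA degM ?monic_neq0 // addnC.
have degp : (0 < deg p)%N.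
  by have p1 : (1 < size p)%N := p_irr.1; rewrite /deg; lia.
have T0 : 0 < (tau g)%:R :> R by rewrite ltr0n tau_gt0.
have := semi_superior_tau_ge hsup (monic_i e.+1) (esym (degS e)).
have : e%:R * #|F|%:R `^ ((deg p)%:R / x) <= e.+1%:R.
  (* For [e = 0] there is no quotient by [p] to compare with, and the bound is trivial. *)
  case: e hsup => [|e] hsup; first by rewrite mul0r.
  have := semi_superior_tau_le hsup (monic_i e) (esym (degS e)).
  rewrite !tau_expM // !natrM mulrAC [leRHS]mulrC [leLHS]mulrC.
  by rewrite ler_pM2l // mulrC.
rewrite !tau_expM // !natrM.
have := powR_card_gt1 degp.
set Q := _ `^ _ => Q1 up; rewrite mulrAC ler_pM2r // => low.
have Q10 : 0 < Q - 1 by rewrite subr_gt0.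
rewrite -[_^-1]mul1r ler_pdivlMr // ler_pdivrMr //.
move: up low; rewrite -!natr1; move: (e%:R) => E up low.
by apply/andP; split; lra.
Qed.

End Exponents.

(** * Powers of q at the special values of [x] *)

Section RationalBase.
Variables (R : realType) (F : finFieldType) (s r : nat) (x : R).
Hypotheses (s_gt0 : (0 < s)%N) (r_gt0 : (0 < r)%N).
Hypothesis xE : x = s%:R * ln (#|F|%:R) / ln (1 + 1 / r%:R).

Let lnq_gt0 : 0 < ln (#|F|%:R) :> R.
Proof. by rewrite ln_gt0 // ltr1n finNzRing_gt1. Qed.

Let r1_gt1 : 1 < 1 + 1 / r%:R :> R.
Proof. by rewrite ltrDl divr_gt0 ?ltr0n. Qed.

Let lnr_gt0 : 0 < ln (1 + 1 / r%:R) :> R.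
Proof. by rewrite ln_gt0. Qed.

Lemma rational_base_gt0 : 0 < x.
Proof. by rewrite xE divr_gt0 // mulr_gt0 // ltr0n. Qed.

(** Since x log(1 + 1/r) = s log q, the lower end of the range for epsilon is log Q. *)
Lemma ln_powR_card (k : nat) :
  ln (#|F|%:R `^ (k%:R / x)) = k%:R / s%:R * ln (1 + 1 / r%:R).
Proof.
rewrite ln_powR xE; field.
by rewrite !gt_eqF ?ltr0n.
Qed.

Lemma powR_card_lt (u : nat) : (u < s)%N ->
  #|F|%:R `^ (u%:R / x) < 1 + 1 / r%:R.
Proof.
move=> us; have q0 : 0 < #|F|%:R :> R by rewrite ltr0n ltnW ?finNzRing_gt1.
rewrite -ltr_ln ?posrE ?powR_gt0 ?(lt_trans _ r1_gt1) // ln_powR_card.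
by rewrite gtr_pMl // ltr_pdivrMr ?ltr0n // mul1r ltr_nat.
Qed.

Lemma powR_card_exp (u : nat) :
  (#|F|%:R `^ (u%:R / x)) ^+ s = (1 + 1 / r%:R) ^+ u.
Proof.
have q0 : 0 < #|F|%:R :> R by rewrite ltr0n ltnW ?finNzRing_gt1.
apply: ln_inj; rewrite ?posrE ?exprn_gt0 ?powR_gt0 ?(lt_trans _ r1_gt1) //.
rewrite !lnXn ?powR_gt0 ?(lt_trans _ r1_gt1) // ln_powR_card.
rewrite -[LHS]mulr_natr -[RHS]mulr_natr; field.
by rewrite pnatr_eq0 -lt0n.
Qed.

(* If [#|F| `^ (u / x) = 1 + 1 / m], then [(1 + 1 / m) ^ s = (1 + 1 / r) ^ u]
   forces [m ^ s = r ^ u], hence [m <= r], against [powR_card_lt]. *)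
Lemma powR_card_neq (u m : nat) : (u < s)%N -> (0 < m)%N ->
  #|F|%:R `^ (u%:R / x) != 1 + 1 / m%:R.
Proof.
move=> us m_gt0; apply/eqP => Qm.
have mr : (r < m)%N.
  have := powR_card_lt us.
  by rewrite Qm ltrD2l !mul1r ltf_pV2 ?posrE ?ltr0n // ltr_nat.
have := powR_card_exp u; rewrite Qm.
have frac (k i : nat) : (0 < k)%N ->
    (1 + 1 / k%:R) ^+ i = (k.+1 ^ i)%:R / (k ^ i)%:R :> R.
  move=> k0; rewrite !natrX -expr_div_n -natr1; congr (_ ^+ _); field.
  by rewrite pnatr_eq0 -lt0n.
rewrite !frac //.
move=> /eqP; rewrite eqr_div ?pnatr_eq0 -?lt0n ?expn_gt0 ?m_gt0 ?r_gt0 //.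
rewrite -!natrM eqr_nat => /eqP.
rewrite [RHS]mulnC => /succ_ratio_exp_inj msru.
have : (r ^ u < m ^ s)%N.
  apply: (leq_ltn_trans (leq_pexp2l r_gt0 (ltnW us))).
  by rewrite ltn_exp2r.
by rewrite msru ltnn.
Qed.

Lemma semi_superior_exponentE (p g : {poly F}) (e : nat) :
  p \is monic -> irreducible_poly p -> g \is monic -> ~~ (p %| g) ->
  semi_superior x (p ^+ e * g) -> (deg p < s)%N -> expo F x (deg p) = e.
Proof.
move=> p_monic p_irr g_monic pg hsup ps.
have /andP[lo] := semi_superior_exponent rational_base_gt0 p_monic p_irr
  g_monic pg hsup.
(* The boundary case 1/(Q - 1) = e + 1 would mean Q = 1 + 1/(e + 1), which [powR_card_neq] excludes;
   otherwise the floor is [e]. *)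
rewrite le_eqVlt => /orP[/eqP Qe|hi]; last by apply: truncn_def; rewrite lo.
have /eqP[] := powR_card_neq ps (ltn0Sn e).
by rewrite -Qe mul1r invrK addrC subrK.
Qed.

(** From Q < 1 + 1/r follows 1/(Q - 1) > r >= 1. This makes 1/a_u meaningful and lets [p] be divided
    out of [h]. *)
Lemma expo_gt0 (u : nat) : (0 < u)%N -> (u < s)%N -> (0 < expo F x u)%N.
Proof.
move=> u_gt0 us; rewrite truncn_gt0.
have := powR_card_gt1 F rational_base_gt0 u_gt0.
have := powR_card_lt us; set Q := _ `^ _ => Qr Q1.
rewrite invf_ge1 ?subr_gt0 // lerBlDl (le_trans (ltW Qr)) // lerD2l mul1r.
by rewrite invf_le1 ?ltr0n // ler1n.
Qed.

(** The floor satisfies 1/(Q - 1) < a_u + 1; this controls the length of the range. *)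
Lemma powR_card_gt_expo (u : nat) : (0 < u)%N ->
  1 + 1 / (expo F x u).+1%:R < #|F|%:R `^ (u%:R / x).
Proof.
move=> u_gt0; have := powR_card_gt1 F rational_base_gt0 u_gt0.
set Q := _ `^ _ => Q1.
rewrite -ltrBrDl mul1r invf_plt ?posrE ?ltr0n ?subr_gt0 //.
exact: truncnS_gt.
Qed.

End RationalBase.

(** * The maximum T(N) of [tau] in a given degree *)

Section MaxTau.
Variable F : finFieldType.

Lemma leq_maxtau (f : {poly F}) : f \is monic -> (tau f <= maxtau F (deg f))%N.
Proof.
move=> f_monic; apply: leq_bigmax_seq => //.
rewrite in_fset_set; last exact: finite_monics.
exact/mem_set.
Qed.

Lemma maxtau_leq (N m : nat) :
  (forall f : {poly F}, f \is monic -> deg f = N -> (tau f <= m)%N) ->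
  (maxtau F N <= m)%N.
Proof.
move=> le_m; apply/bigmax_leqP_seq => f.
rewrite in_fset_set; last exact: finite_monics.
by move=> /set_mem[f_monic fN] _; apply: le_m.
Qed.

End MaxTau.

Lemma semi_superior_maxtau_le (R : realType) (F : finFieldType) (x : R)
    (h : {poly F}) (N k : nat) :
  semi_superior x h -> (N + k = deg h)%N ->
  (maxtau F N)%:R * #|F|%:R `^ (k%:R / x) <= (tau h)%:R.
Proof.
move=> hsup Nk.
have q0 : 0 < #|F|%:R `^ (k%:R / x) :> R.
  by rewrite powR_gt0 // ltr0n ltnW ?finNzRing_gt1.
have Tq0 : 0 <= (tau h)%:R / #|F|%:R `^ (k%:R / x) by rewrite divr_ge0 // ltW.
(* [maxtau] is a maximum of natural numbers, so the real bound is replaced by its floor before each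
   [tau f] is bounded. *)
rewrite -ler_pdivlMr // -truncn_ge_nat //.
apply: maxtau_leq => f f_monic fN; rewrite truncn_ge_nat //.
by rewrite ler_pdivlMr // semi_superior_tau_le // fN.
Qed.

Theorem theorem1p3 (R : realType) (F : finFieldType) (s r : nat)
    (hs : (1 <= s)%N) (hr : (1 <= r)%N)
    (x : R) (hx : x = s%:R * ln (#|F|%:R) / ln (1 + 1 / r%:R))
    (h : {poly F}) (hsemi : semi_superior x h)
    (v : nat) (hv : (v < num_irreds F s)%N)
    (hdeg : deg h = (deg (hhat F x) - v * s)%N)
    (u : nat) (hu : (u <= s - 1)%N)
    (N : nat) (hN : N = (deg h - u)%N) :
  (u = 0%N -> ln (maxtau F N)%:R = ln (tau h)%:R :> R) /\
  ((1 <= u)%N ->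
    let a : R := (expo F x u)%:R in
    let lower : R := u%:R / s%:R * ln (1 + 1 / r%:R) in
    let upper : R := ln (1 + 1 / a) in
    [/\ exists eps : R,
          ln (maxtau F N)%:R = ln (tau h)%:R - eps /\ lower <= eps <= upper,
        upper - lower <= ln (1 + 1 / (a * (a + 2)))
      & ln (1 + 1 / (a * (a + 2))) <= ln (4 / 3)]).
Proof.
have x_gt0 := rational_base_gt0 hs hr hx.
have h_monic := hsemi.1; have tauh := tau_gt0 (monic_neq0 h_monic).
split=> [u0|u_gt0].
  have {}hN : N = deg h by rewrite hN u0 subn0.
  congr (ln _%:R); apply/eqP; rewrite eqn_leq {2}hN leq_maxtau // andbT.
  have := semi_superior_maxtau_le hsemi (etrans (addn0 N) hN).
  by rewrite mul0r powRr0 mulr1 ler_nat.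
have us : (u < s)%N by lia.
have [p [p_monic p_irr szp]] := exists_irreducible_poly F u_gt0.
have degp : deg p = u by rewrite /deg szp.
have [e [g [hE g_monic pg]]] := monic_factor_out p_monic p_irr h_monic.
have eE : expo F x u = e.
  rewrite -degp; apply: (semi_superior_exponentE hs hr hx) g_monic pg _ _ => //.
    by rewrite -hE.
  by rewrite degp.
have e_gt0 : (0 < e)%N by rewrite -eE (expo_gt0 hs hr hx).
have := powR_card_gt_expo hs hr hx u_gt0.
have <- := ln_powR_card hs hr hx u; rewrite eE.
have q_gt0 : 0 < #|F|%:R :> R by rewrite ltr0n ltnW ?finNzRing_gt1.
have := powR_gt0 (u%:R / x) q_gt0.
(* This is h / p; [e_gt0] makes [e.-1] a true predecessor. *)
pose f := p ^+ e.-1 * g.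
have hf : h = p * f by rewrite hE /f mulrA -exprS prednK.
have f_monic : f \is monic by rewrite /f rpredM ?rpredX.
(* As [p] divides [h], u <= deg h and the truncated subtraction defining [N] is exact. *)
have degh : deg h = (N + u)%N.
  by rewrite hN hf degM ?monic_neq0 // degp addKn addnC.
have degf : deg f = N by rewrite hN hf degM ?monic_neq0 // degp addKn.
have tauhE : (e * tau h = e.+1 * tau f)%N.
  by rewrite hE /f !tau_expM ?(monic_neq0 g_monic) // prednK // mulnCA.
have := semi_superior_maxtau_le hsemi (esym degh).
set Q := _ `^ _ => maxQ Q_gt0 Qe a lower upper.
have max_ge : (tau f <= maxtau F N)%N by rewrite -degf leq_maxtau.
have max_gt0 : (0 < maxtau F N)%N.
  exact: leq_trans (tau_gt0 (monic_neq0 f_monic)) max_ge.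
have a_ge1 : 1 <= a by rewrite ler1n.
split.
- exists (ln (tau h)%:R - ln (maxtau F N)%:R); split; first by rewrite subKr.
  rewrite -ln_div ?posrE ?ltr0n // !ler_ln ?posrE ?divr_gt0 ?ltr0n //.
    rewrite ler_pdivlMr ?ltr0n // mulrC maxQ /=.
    rewrite ler_pdivrMr ?ltr0n //.
    (* T(N) is at least [tau f], which is a/(a + 1) times [tau h]. *)
    have : a * (tau h)%:R <= (a + 1) * (maxtau F N)%:R.
      by rewrite natr1 -!natrM ler_nat tauhE leq_mul2l max_ge orbT.
    have -> : (1 + 1 / a) = (a + 1) / a by field; lra.
    by rewrite mulrAC ler_pdivlMr 1?mulrC //; lra.
  by rewrite addr_gt0 // divr_gt0 //; lra.
- have aa_gt0 : 0 < a * (a + 2) by rewrite mulr_gt0; lra.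
  have up_gt0 : 0 < 1 + 1 / a by rewrite addr_gt0 // divr_gt0 //; lra.
  rewrite -ln_div ?posrE // ler_ln ?posrE ?divr_gt0 //; last first.
    by rewrite addr_gt0 // divr_gt0.
  rewrite ler_pdivrMr //.
  (* This factorization reduces the length bound to 1 + 1/(a + 1) <= Q. *)
  have -> : 1 + 1 / a = (1 + 1 / (a * (a + 2))) * (1 + 1 / (a + 1)).
    by field; rewrite !gt_eqF //; lra.
  rewrite ler_pM2l ?addr_gt0 ?divr_gt0 //.
  by rewrite natr1 ltW.
(* The extreme case is a = 1, where 1 + 1/3 = 4/3. *)
- have aa_ge3 : 3 <= a * (a + 2) by nra.
  rewrite ler_ln ?posrE ?divr_gt0 ?addr_gt0 //; try lra.
    rewrite -lerBrDl ler_pdivrMr; last lra.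
    lra.
  by rewrite divr_gt0 //; lra.
Qed.
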